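(* Every nonabelian $6$-dimensional nilpotent real Lie algebra has a Ricci-flat metric that is not flat.
   Context: A metric on a Lie algebra $\mathfrak{g}$ is a nondegenerate symmetric bilinear form (of any signature), identified with the left-invariant pseudo-Riemannian metric it defines on a Lie group with Lie algebra $\mathfrak{g}$; Ricci-flat (resp. flat) means that the Ricci tensor (resp. the full curvature tensor) of its Levi-Civita connection vanishes. *)

(* Defs.v *)
From HB Require Import structures.
From mathcomp Require Import all_boot all_order all_algebra boolp reals.
From mathcomp Require Import ring.

Set Implicit Arguments.
Unset Strict Implicit.
Unset Printing Implicit Defensive.

Import Order.TTheory GRing.Theory Num.Theory.
Local Open Scope ring_scope.

Section LieAlgebra.
Variables (K : fieldType) (V : vectType K).
Implicit Types (br nabla : {bilinear V -> V -> V}) (g : {symmetric V}).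

Definition is_lie_bracket br : Prop :=
  (forall x, br x x = 0) /\
  (forall x y z, br x (br y z) + br y (br z x) + br z (br x y) = 0).

Definition lie_abelian br : Prop := forall x y, br x y = 0.

(* The subspace [U, W] spanned by all brackets; by bilinearity brackets of
   basis vectors suffice, see [lie_productP]. *)
Definition lie_product br (U W : {vspace V}) : {vspace V} :=
  <<[seq br x y | x <- vbasis U, y <- vbasis W]>>%VS.

Definition lower_central br (k : nat) : {vspace V} :=
  iter k (lie_product br fullv) fullv.

Definition lie_nilpotent br : Prop := exists k, lower_central br k = 0%VS.

(* A left-invariant connection is determined by its values on left-invariant
   vector fields, i.e. by a bilinear map V x V -> V.  For left-invariant x, y, z
   the function <y, z> is constant, so that metric compatibility
   x.<y, z> = <nabla_x y, z> + <y, nabla_x z> has left-hand side 0. *)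
Definition levi_civita br g nabla : Prop :=
  (forall x y, nabla x y - nabla y x = br x y) /\
  (forall x y z, g (nabla x y) z + g y (nabla x z) = 0).

(* R(x, y) z; vanishing of the curvature and Ricci tensors on left-invariant
   fields is vanishing of the tensors, since these frame the tangent bundle. *)
Definition curvature br nabla (x y z : V) : V :=
  nabla x (nabla y z) - nabla y (nabla x z) - nabla (br x y) z.

(* Trace of a linear endomorphism, computed in some basis (the choice is immaterial). *)
Definition vtrace (f : V -> V) : K :=
  \sum_(i < \dim {:V}) coord (vbasis {:V}) i (f (vbasis {:V})`_i).

(* Ric(y, z) = tr (x |-> R(x, y) z). *)
Definition ricci br nabla (y z : V) : K :=
  vtrace (fun x => curvature br nabla x y z).

Definition ricci_flat br nabla : Prop := forall y z, ricci br nabla y z = 0.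

Definition flat br nabla : Prop := forall x y z, curvature br nabla x y z = 0.

Lemma lie_productP br (U W Z : {vspace V}) :
  (lie_product br U W <= Z)%VS <->
  (forall x y, x \in U -> y \in W -> br x y \in Z).
Proof.
split=> [/span_subvP sZ x y xU yW|sZ].
  rewrite (coord_vbasis xU) (coord_vbasis yW).
  rewrite linear_sumlz memv_suml // => i _.
  rewrite linear_sumr memv_suml // => j _.
  rewrite linearZr_LR linearZl_LR !memvZ //.
  by apply: sZ; apply: allpairs_f; rewrite mem_nth ?size_tuple.
apply/span_subvP => _ /allpairsP[[x y] /= [xU yW ->]].
by apply: sZ; apply: vbasis_mem.
Qed.

End LieAlgebra.

Section LeviCivita.
Variables (K : numFieldType) (V : vectType K).
Variables (br : {bilinear V -> V -> V}) (g : {symmetric V}).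
Hypotheses (lie_br : is_lie_bracket br) (g_nondeg : nondegenerate g).

Let gC x y : g x y = g y x.
Proof. by rewrite hermC expr0 mul1r. Qed.

Let g_inj x y : (forall z, g x z = g y z) -> x = y.
Proof.
move=> gxy; apply/eqP; rewrite -subr_eq0 -memv0 -(eqP g_nondeg).
by apply/mem_orthovP => z _; rewrite linearBl /= gxy subrr.
Qed.

Let brC x y : br x y = - br y x.
Proof.
have [alt _] := lie_br; apply/eqP; rewrite -addr_eq0; apply/eqP.
by have := alt (x + y); rewrite linearDr !linearDl /= !alt add0r addr0 addrC.
Qed.

Let koszul x y z : K := 2^-1 * (g (br x y) z - g (br y z) x + g (br z x) y).

Let koszulE nabla : levi_civita br g nabla ->
  forall x y z, g (nabla x y) z = koszul x y z.
Proof.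
move=> [tf cpt] x y z.
have two0 : (2 : K) != 0 by rewrite pnatr_eq0.
rewrite /koszul -!tf !linearBl /=.
have := cpt x y z; have := cpt y z x; have := cpt z x y.
rewrite [g y (nabla x z)]gC [g z (nabla y x)]gC [g x (nabla z y)]gC.
by do 3![move/eqP; rewrite addr_eq0 => /eqP ->]; field.
Qed.

Let koszul_is_linear x y : linear_for *%R (koszul x y).
Proof.
move=> a u v; by rewrite /koszul !(linearPr, linearPl) /=; ring.
Qed.

Let flatmx (x : V) : 'rV[K]_(\dim {:V}) := \row_i g x (vbasis {:V})`_i.

Let flatmx_is_linear : linear flatmx.
Proof. by move=> a x y; apply/rowP => i; rewrite !mxE linearPl. Qed.

Let flatmx_surj u : exists x, flatmx x = u.
Proof.
pose flin := HB.pack_for {linear V -> 'rV[K]_(\dim {:V})} flatmx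
  (GRing.isLinear.Build K V 'rV[K]_(\dim {:V}) *:%R flatmx flatmx_is_linear).
pose F := linfun flin.
have kerF : lker F == 0%VS.
  apply/lker0P => x y; rewrite !lfunE /= => /rowP Fxy; apply: g_inj => z.
  rewrite (coord_vbasis (memvf z)) !linear_sumr; apply: eq_bigr => i _.
  by rewrite !linearZr_LR /=; have := Fxy i; rewrite !mxE => ->.
have imF : limg F = fullv.
  apply/eqP; rewrite eqEdim subvf limg_dim_eq ?(eqP kerF) ?capv0 //.
  by rewrite dimvf /dim /= mul1n.
have /memv_imgP[x _ ->] : u \in limg F by rewrite imF memvf.
by exists x; rewrite lfunE.
Qed.

Let koszul_repr x y : exists v, forall z, g v z = koszul x y z.
Proof.
have [v /rowP vE] := flatmx_surj (\row_i koszul x y (vbasis {:V})`_i).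
pose k := HB.pack_for {linear V -> K | *%R} (koszul x y)
  (GRing.isLinear.Build K V K *%R (koszul x y) (koszul_is_linear x y)).
exists v => z; rewrite -[RHS]/(k z) (coord_vbasis (memvf z)).
rewrite !linear_sum; apply: eq_bigr => i _.
by rewrite !linearZ_LR /=; have := vE i; rewrite !mxE => ->.
Qed.

(* For a nondegenerate g, the connection in [levi_civita br g nabla] exists and
   is unique, so that [ricci_flat] and [flat] are properties of the metric. *)
Lemma levi_civita_exists : exists nabla, levi_civita br g nabla.
Proof.
have two0 : (2 : K) != 0 by rewrite pnatr_eq0.
pose nb x y := sval (cid (koszul_repr x y)).
have nbE x y z : g (nb x y) z = koszul x y z.
  exact: (svalP (cid (koszul_repr x y))).
have nbB : bilinear_for *:%R *:%R nb.
  split=> [y|x] a u v; apply: g_inj => z; rewrite linearPl /= !nbE /koszul.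
    by rewrite !(linearPl, linearPr) /=; ring.
  by rewrite !(linearPl, linearPr) /=; ring.
pose nabla := HB.pack_for {bilinear V -> V -> V} nb
  (bilinear_isBilinear.Build K V V V *:%R *:%R nb nbB).
exists nabla; split=> [x y|x y z].
  apply: g_inj => z; rewrite linearBl /= !nbE /koszul.
  by rewrite (brC y x) (brC x z) (brC z y) !linearNl /=; field.
rewrite (gC y) /= !nbE /koszul.
by rewrite (brC z x) (brC y x) (brC z y) !linearNl /=; field.
Qed.

Lemma levi_civita_unique nabla1 nabla2 :
  levi_civita br g nabla1 -> levi_civita br g nabla2 -> nabla1 =2 nabla2.
Proof.
move=> lc1 lc2 x y; apply: g_inj => z.
by rewrite (koszulE lc1) (koszulE lc2).
Qed.

End LeviCivita.

(* Main.v *)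
(* A nonabelian nilpotent Lie algebra of dimension 6 carries an abelian ideal
   I3 = <x1, x2, x3> in a flag of ideals, such that x3 commutes with x2.

   If the centralizer of I3 is larger than I3, then I3 extends to an abelian
   ideal I4 = <x1, x2, x3, x4>, and the complement x5, x6 can be chosen so that
   x5 commutes with x2.  All metrics which pair x_i with x_(7-i), and have
   g(x4, x4) = h arbitrary, are then Ricci-flat.  One component of the curvature
   is affine in h, with slope a negative multiple of (p5 + q6)^2 + 3 u4^2, where
   [x5, x3] = p5 x1, [x6, x3] = p6 x1 + q6 x2 and u4 is the x4-coefficient of
   [x6, x5]; a suitable choice of the flag makes this slope nonzero.

   If I3 is its own centralizer, then the algebra acts on I3 by all strictly
   triangular matrices; this determines the algebra up to four parameters, and
   a metric pairing x1 with x5, x2 with x4, and x3 and x6 with themselves, is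
   Ricci-flat and not flat. *)
Require Import Defs.
From HB Require Import structures.
From mathcomp Require Import all_boot all_order all_algebra reals.
From mathcomp Require Import boolp ring zify.

Set Implicit Arguments.
Unset Strict Implicit.
Unset Printing Implicit Defensive.

Import Order.TTheory GRing.Theory Num.Theory.
Local Open Scope ring_scope.

Definition has_ricci_flat_not_flat (K : fieldType) (V : vectType K)
    (br : {bilinear V -> V -> V}) :=
  exists (g : {symmetric V}) (nabla : {bilinear V -> V -> V}),
    [/\ nondegenerate g, levi_civita br g nabla,
        ricci_flat br nabla & ~ flat br nabla].

(** * Connections, metrics and curvature in coordinates *)

Section Tables.
Variables (K : fieldType) (V : vectType K) (n : nat) (b : n.-tuple V).
Hypothesis b_basis : basis_of fullv b.

Let b_free : free b. Proof. exact: basis_free b_basis. Qed.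

Let coord_b (i j : 'I_n) : coord b j b`_i = (i == j)%:R.
Proof. by rewrite coord_free. Qed.

Let bE x : x = \sum_(i < n) coord b i x *: b`_i.
Proof. by apply: coord_basis (memvf x). Qed.

(** The map [f] is unbundled so that a multilinear identity can be reduced to basis vectors one
    argument at a time. *)
Lemma linear_eq0_basis (W : lmodType K) (f : V -> W) :
  linear f -> (forall i : 'I_n, f b`_i = 0) -> forall x, f x = 0.
Proof.
move=> lin_f f_b x.
pose F := HB.pack_for {linear V -> W} f (GRing.isLinear.Build K V W *:%R _ lin_f).
rewrite -[LHS]/(F x) (bE x) linear_sum big1 // => i _.
by rewrite linearZ /= f_b scaler0.
Qed.

(** Independence of the trace from the basis: expand each basis in the other and exchange the sums.
    It allows Ricci traces to be taken in an adapted frame. *)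
Lemma vtrace_basis (f : {linear V -> V}) :
  vtrace f = \sum_(i < n) coord b i (f b`_i).
Proof.
transitivity (\sum_(i < \dim {:V}) \sum_(j < n)
    coord b j (vbasis {:V})`_i * coord (vbasis {:V}) i (f b`_j)).
  apply: eq_bigr => i _; rewrite {1}[(vbasis _)`_i]bE !linear_sum.
  by apply: eq_bigr => j _; rewrite !linearZ.
rewrite exchange_big; apply: eq_bigr => j _ /=.
rewrite [in RHS](coord_vbasis (memvf (f b`_j))) linear_sum.
by apply: eq_bigr => i _; rewrite linearZ /= mulrC.
Qed.

(** Tables take natural numbers rather than ordinals as indices, so that concrete ones can be given
    by matching on numerals and evaluated by computation. *)
Definition table_map (T : nat -> nat -> nat -> K) (x y : V) : V :=
  \sum_(i < n) \sum_(j < n) \sum_(k < n)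
    (coord b i x * coord b j y * T i j k) *: b`_k.

Definition table_form (S : nat -> nat -> K) (x y : V) : K :=
  \sum_(i < n) \sum_(j < n) coord b i x * coord b j y * S i j.

Lemma table_map_bilinear T : bilinear_for *:%R *:%R (table_map T).
Proof.
split=> [y|x] a u v; rewrite /= /table_map scaler_sumr -big_split;
  apply: eq_bigr => i _ /=; rewrite scaler_sumr -big_split;
  apply: eq_bigr => j _ /=; rewrite scaler_sumr -big_split;
  apply: eq_bigr => k _ /=; rewrite linearP /= scalerA -scalerDl;
  by congr (_ *: _); ring.
Qed.

Lemma table_form_bilinear S : bilinear_for *%R *%R (table_form S).
Proof.
split=> [y|x] a u v; rewrite /= /table_form mulr_sumr -big_split;
  apply: eq_bigr => i _ /=; rewrite mulr_sumr -big_split;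
  by apply: eq_bigr => j _ /=; rewrite linearP /=; ring.
Qed.

Lemma table_map_basis T (i j : 'I_n) :
  table_map T b`_i b`_j = \sum_(k < n) T i j k *: b`_k.
Proof.
rewrite /table_map (bigD1 i) //= [X in _ + X]big1 ?addr0 => [|i' /negbTE ne_i].
  rewrite (bigD1 j) //= [X in _ + X]big1 ?addr0 => [|j' /negbTE ne_j].
    by apply: eq_bigr => k _; rewrite !coord_b !eqxx !mul1r.
  by apply: big1 => k _; rewrite !coord_b [j == _]eq_sym ne_j mulr0 mul0r scale0r.
apply: big1 => j' _; apply: big1 => k _.
by rewrite coord_b eq_sym ne_i !mul0r scale0r.
Qed.

Lemma table_form_basis S (i j : 'I_n) : table_form S b`_i b`_j = S i j.
Proof.
rewrite /table_form (bigD1 i) //= [X in _ + X]big1 ?addr0 => [|i' /negbTE ne_i].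
  rewrite (bigD1 j) //= [X in _ + X]big1 ?addr0 => [|j' /negbTE ne_j].
    by rewrite !coord_b !eqxx !mul1r.
  by rewrite !coord_b [j == _]eq_sym ne_j mulr0 mul0r.
by apply: big1 => j' _; rewrite coord_b eq_sym ne_i !mul0r.
Qed.

(** The component along [b_m] of R(b_i, b_j) b_k, for structure constants [c] and Christoffel
    symbols [G]. *)
Definition curvature_table (c G : nat -> nat -> nat -> K) (i j k m : nat) : K :=
  \sum_(0 <= l < n) (G j k l * G i l m - G i k l * G j l m - c i j l * G l k m).

Section Connection.
Variables (br nabla : {bilinear V -> V -> V}).
Variables (c G : nat -> nat -> nat -> K).
Hypothesis br_tab :
  forall i j : 'I_n, br b`_i b`_j = \sum_(k < n) c i j k *: b`_k.
Hypothesis nabla_tab :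
  forall i j : 'I_n, nabla b`_i b`_j = \sum_(k < n) G i j k *: b`_k.

Lemma curvature_basis (i j k : 'I_n) :
  curvature br nabla b`_i b`_j b`_k =
  \sum_(m < n) curvature_table c G i j k m *: b`_m.
Proof.
rewrite /curvature !nabla_tab br_tab !linear_sumr linear_sumlz.
under eq_bigr do rewrite linearZr_LR nabla_tab scaler_sumr /=.
under [X in _ - X - _]eq_bigr do rewrite linearZr_LR nabla_tab scaler_sumr /=.
under [X in _ - _ - X]eq_bigr do rewrite linearZl_LR nabla_tab scaler_sumr /=.
rewrite exchange_big [X in _ - X - _]exchange_big [X in _ - _ - X]exchange_big.
rewrite -!sumrB; apply: eq_bigr => m _.
rewrite -!sumrB /curvature_table big_mkord scaler_suml.
by apply: eq_bigr => l _; rewrite !scalerA -!scalerBl.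
Qed.

Lemma curvature_linearl y z : linear (fun x => curvature br nabla x y z).
Proof.
move=> a u v; rewrite /curvature !(linearPl, linearPr) /= !scalerBr.
by rewrite !opprD [RHS]addrACA; congr (_ + _); rewrite addrACA.
Qed.

Lemma curvature_linearr x y : linear (curvature br nabla x y).
Proof.
move=> a u v; rewrite /curvature !linearPr /= !scalerBr.
by rewrite !opprD [RHS]addrACA; congr (_ + _); rewrite addrACA.
Qed.

Lemma curvature_linearm x z : linear (fun y => curvature br nabla x y z).
Proof.
move=> a u v; rewrite /curvature !(linearPl, linearPr) /= !scalerBr.
by rewrite !opprD [RHS]addrACA; congr (_ + _); rewrite addrACA.
Qed.

(** The scalars are viewed as the module [K^o], the form of codomain that [linear_eq0_basis]
    expects. *)
Lemma ricci_linearl z : linear (fun y => ricci br nabla y z : K^o).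
Proof.
move=> a u v; rewrite /ricci /vtrace scaler_sumr -big_split /=.
by apply: eq_bigr => i _; rewrite curvature_linearm linearP.
Qed.

Lemma ricci_linearr y : linear (ricci br nabla y : V -> K^o).
Proof.
move=> a u v; rewrite /ricci /vtrace scaler_sumr -big_split /=.
by apply: eq_bigr => i _; rewrite curvature_linearr linearP.
Qed.

Lemma ricci_basis (j k : 'I_n) :
  ricci br nabla b`_j b`_k =
  \sum_(0 <= i < n) curvature_table c G i j k i.
Proof.
pose f := HB.pack_for {linear V -> V} (fun x => curvature br nabla x b`_j b`_k)
  (GRing.isLinear.Build K V V *:%R _ (curvature_linearl b`_j b`_k)).
rewrite [LHS](vtrace_basis f) big_mkord; apply: eq_bigr => i _ /=.
rewrite curvature_basis linear_sum (bigD1 i) //= [X in _ + X]big1 ?addr0.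
  by rewrite linearZ /= coord_b eqxx mulr1.
by move=> m /negbTE ne_m; rewrite linearZ /= coord_b ne_m mulr0.
Qed.

Lemma ricci_flat_table :
  (forall j k, (j < n)%N -> (k < n)%N ->
     \sum_(0 <= i < n) curvature_table c G i j k i = 0) ->
  ricci_flat br nabla.
Proof.
move=> ric0 y z; move: y; apply: linear_eq0_basis (ricci_linearl z) _ => j.
move: z; apply: linear_eq0_basis (ricci_linearr _) _ => k.
by rewrite ricci_basis ric0.
Qed.

Lemma not_flat_table i j k m :
  (i < n)%N -> (j < n)%N -> (k < n)%N -> (m < n)%N ->
  curvature_table c G i j k m != 0 -> ~ flat br nabla.
Proof.
move=> ltin ltjn ltkn ltmn /eqP nz flat0; apply: nz.
have [o <-] : {o : 'I_n | o = m :> nat} by exists (Ordinal ltmn).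
have := curvature_basis (Ordinal ltin) (Ordinal ltjn) (Ordinal ltkn).
rewrite flat0 => /(congr1 (coord b o)).
rewrite linear0 linear_sum (bigD1 o) //= [X in _ + X]big1 ?addr0.
  by rewrite linearZ /= coord_b eqxx mulr1.
by move=> m' /negbTE ne_m; rewrite linearZ /= coord_b ne_m mulr0.
Qed.

End Connection.

Section Metric.
Variables (S S' : nat -> nat -> K).
Hypothesis S_sym : forall i j, (i < n)%N -> (j < n)%N -> S i j = S j i.
Hypothesis S_inv : forall i k, (i < n)%N -> (k < n)%N ->
  \sum_(0 <= j < n) S i j * S' j k = (i == k)%:R.

(** Here [S'] is the inverse Gram matrix: the k-th coordinate of [u] is the sum over j of
    [g u b_j * S' j k], so a vector orthogonal to everything is zero. *)
Lemma metric_table : exists2 g : {symmetric V}, nondegenerate g &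
  forall i j : 'I_n, g b`_i b`_j = S i j.
Proof.
have symS x y : table_form S x y = (-1) ^+ false * idfun (table_form S y x).
  rewrite expr0 mul1r /= /table_form exchange_big; apply: eq_bigr => i _.
  by apply: eq_bigr => j _; rewrite S_sym // mulrAC [_ * coord b j _]mulrC mulrAC.
pose g := HB.pack_for {symmetric V} (table_form S)
  (bilinear_isBilinear.Build K V V K *%R *%R _ (table_form_bilinear S))
  (isHermitianSesquilinear.Build K V false idfun _ symS).
have gE (i j : 'I_n) : g b`_i b`_j = S i j by exact: table_form_basis.
exists g => //; move: g gE => {symS} g gE.
apply/eqP/vspaceP => u; rewrite memv0; apply/idP/eqP => [/mem_orthovP gu0|->].
  rewrite (bE u) big1 // => k _; suff -> : coord b k u = 0 by rewrite scale0r.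
  transitivity (\sum_(j < n) g u b`_j * S' j k); last first.
    by apply: big1 => j _; rewrite gu0 ?memvf // mul0r.
  under eq_bigr => j _ do rewrite {1}(bE u) linear_sumlz mulr_suml.
  rewrite exchange_big -[LHS]mulr1 -[LHS]addr0 (bigD1 k) //=; congr (_ + _).
    under eq_bigr => j _ do rewrite linearZl_LR /= gE -mulrA.
    by rewrite -mulr_sumr -(big_mkord xpredT (fun j => S k j * S' j k)) S_inv ?eqxx.
  rewrite big1 // => i ne_i.
  under eq_bigr => j _ do rewrite linearZl_LR /= gE -mulrA.
  rewrite -mulr_sumr -(big_mkord xpredT (fun j => S i j * S' j k)) S_inv //.
  by rewrite val_eqE (negbTE ne_i) mulr0.
exact: mem0v.
Qed.

End Metric.

(** Reduces the geometric claim to finitely many scalar identities and one inequality. The candidate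
    connection [G] is supplied as data and only verified, instead of being computed from the
    metric. *)
Lemma ricci_flat_not_flat_tables (br : {bilinear V -> V -> V})
    (c G : nat -> nat -> nat -> K) (S S' : nat -> nat -> K) (i j k m : nat) :
    (forall i j, (i < n)%N -> (j < n)%N ->
       br b`_i b`_j = \sum_(0 <= k < n) c i j k *: b`_k) ->
    (forall i j, (i < n)%N -> (j < n)%N -> S i j = S j i) ->
    (forall i k, (i < n)%N -> (k < n)%N ->
       \sum_(0 <= j < n) S i j * S' j k = (i == k)%:R) ->
    (forall i j k, (i < n)%N -> (j < n)%N -> (k < n)%N ->
       G i j k - G j i k = c i j k) ->
    (forall i j k, (i < n)%N -> (j < n)%N -> (k < n)%N ->
       \sum_(0 <= l < n) (G i j l * S l k + G i k l * S j l) = 0) ->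
    (forall j k, (j < n)%N -> (k < n)%N ->
       \sum_(0 <= i < n) curvature_table c G i j k i = 0) ->
    (i < n)%N -> (j < n)%N -> (k < n)%N -> (m < n)%N ->
    curvature_table c G i j k m != 0 ->
  has_ricci_flat_not_flat br.
Proof.
move=> br_nat S_sym S_inv tf cpt ric0 ltin ltjn ltkn ltmn nz.
have br_tab (i' j' : 'I_n) : br b`_i' b`_j' = \sum_(k' < n) c i' j' k' *: b`_k'.
  by rewrite br_nat // big_mkord.
have [g g_nd gE] := metric_table S_sym S_inv.
pose nabla := HB.pack_for {bilinear V -> V -> V} (table_map G)
  (bilinear_isBilinear.Build K V V V *:%R *:%R _ (table_map_bilinear G)).
have nabla_tab (i' j' : 'I_n) : nabla b`_i' b`_j' = \sum_(k' < n) G i' j' k' *: b`_k'.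
  exact: table_map_basis.
exists g, nabla; split=> //.
- split=> [x y|x y z].
    apply/eqP; rewrite -subr_eq0; apply/eqP; move: x.
    apply: linear_eq0_basis => [a u v|i'].
      rewrite !(linearPl, linearPr) /= !scalerBr.
      by rewrite !opprD [RHS]addrACA; congr (_ + _); rewrite addrACA.
    move: y; apply: linear_eq0_basis => [a u v|j'].
      rewrite !(linearPl, linearPr) /= !scalerBr.
      by rewrite !opprD [RHS]addrACA; congr (_ + _); rewrite addrACA.
    rewrite !nabla_tab br_tab -!sumrB big1 // => k' _.
    by rewrite -!scalerBl tf // subrr scale0r.
  move: x; apply: (@linear_eq0_basis K^o) => [a u v|i'].
    by rewrite !(linearPl, linearPr) /= scalerDr addrACA.
  move: y; apply: (@linear_eq0_basis K^o) => [a u v|j'].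
    by rewrite !(linearPl, linearPr) /= scalerDr addrACA.
  move: z; apply: (@linear_eq0_basis K^o) => [a u v|k'].
    by rewrite !(linearPl, linearPr) /= scalerDr addrACA.
  rewrite !nabla_tab linear_sumlz linear_sumr -big_split /=.
  rewrite -[RHS](cpt i' j' k') // big_mkord; apply: eq_bigr => l _.
  by rewrite linearZr_LR linearZl_LR /= !gE.
- exact: ricci_flat_table br_tab nabla_tab ric0.
- exact: not_flat_table br_tab nabla_tab _ _ _ _ ltin ltjn ltkn ltmn nz.
Qed.

End Tables.

(** * Coordinates in spans of at most four vectors *)

Section Spans.
Variables (K : fieldType) (V : vectType K).

Lemma span1P (x x1 : V) : x \in <<[:: x1]>>%VS -> exists k1, x = k1 *: x1.
Proof. by rewrite span_seq1 => /vlineP[k ->]; exists k. Qed.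

Lemma span2P (x x1 x2 : V) : x \in <<[:: x2; x1]>>%VS ->
  exists k1 k2, x = k1 *: x1 + k2 *: x2.
Proof.
rewrite span_cons => /memv_addP[_ /vlineP[k ->] [w /span1P[k1 ->] ->]].
by exists k1, k; rewrite addrC.
Qed.

Lemma span3P (x x1 x2 x3 : V) : x \in <<[:: x3; x2; x1]>>%VS ->
  exists k1 k2 k3, x = k1 *: x1 + k2 *: x2 + k3 *: x3.
Proof.
rewrite span_cons => /memv_addP[_ /vlineP[k ->] [w /span2P[k1 [k2 ->]] ->]].
by exists k1, k2, k; rewrite addrC.
Qed.

Lemma span4P (x x1 x2 x3 x4 : V) : x \in <<[:: x4; x3; x2; x1]>>%VS ->
  exists k1 k2 k3 k4, x = k1 *: x1 + k2 *: x2 + k3 *: x3 + k4 *: x4.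
Proof.
rewrite span_cons => /memv_addP[_ /vlineP[k ->] [w /span3P[k1 [k2 [k3 ->]]] ->]].
by exists k1, k2, k3, k; rewrite addrC.
Qed.

Lemma subvN_span (B : {vspace V}) (X : seq V) :
  (size X < \dim B)%N -> ~~ (B <= <<X>>)%VS.
Proof.
move=> ltXB; apply: contraL ltXB => /dimvS leBX.
by rewrite -leqNgt (leq_trans leBX) ?dim_span.
Qed.

End Spans.

(** * Ideals, centralizers and flags in a nilpotent Lie algebra *)

Section Ideals.
Variables (K : fieldType) (V : vectType K) (br : {bilinear V -> V -> V}).
Hypothesis lie_br : is_lie_bracket br.

Lemma br_xx x : br x x = 0. Proof. by have [] := lie_br. Qed.

Lemma br_anti x y : br x y = - br y x.
Proof.
apply/eqP; rewrite -addr_eq0; apply/eqP; have := br_xx (x + y).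
by rewrite linearDr !linearDl /= !br_xx add0r addr0 addrC.
Qed.

Lemma lie_jacobi x y z : br (br x y) z = br x (br y z) - br y (br x z).
Proof.
have [_ /(_ x y z)] := lie_br.
rewrite (br_anti z (br x y)) (br_anti z x) linearNr /= => /eqP.
by rewrite subr_eq0 => /eqP <-.
Qed.

Definition lie_ideal (A : {vspace V}) := forall y x, x \in A -> br y x \in A.

Definition ad (x : V) : 'End(V) := linfun (br x).

Lemma adE x y : ad x y = br x y. Proof. by rewrite lfunE. Qed.

Lemma mem_lker_ad x y : (y \in lker (ad x)) = (br x y == 0).
Proof. by rewrite memv_ker adE. Qed.

Lemma span_ideal X :
  (forall y x, x \in X -> br y x \in <<X>>%VS) -> lie_ideal <<X>>%VS.
Proof.
move=> brX y x xX; rewrite -adE memv_preim; apply: (subvP _ _ xX).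
by apply/span_subvP => z zX; rewrite -memv_preim adE brX.
Qed.

Lemma span_commute X : {in X &, forall x y, br x y = 0} ->
  {in <<X>>%VS &, forall x y, br x y = 0}.
Proof.
move=> comX x y xX yX; apply/eqP; rewrite -mem_lker_ad.
apply: (subvP _ _ yX); apply/span_subvP => z zX.
rewrite mem_lker_ad br_anti oppr_eq0 -mem_lker_ad.
apply: (subvP _ _ xX); apply/span_subvP => t tX.
by rewrite mem_lker_ad comX.
Qed.

(** By Jacobi, [x, [y, z]] = [y, [x, z]] - [[y, x], z]; the first term vanishes because z commutes
    with x, the second by [com]. *)
Lemma centralizer_ideal (B : {vspace V}) (x : V) :
    lie_ideal B -> (forall y z, z \in B -> br (br y x) z = 0) ->
  lie_ideal (B :&: lker (ad x)).
Proof.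
move=> idB com y z; rewrite !memv_cap !mem_lker_ad => /andP[zB /eqP xz].
rewrite idB //=; have := lie_jacobi y x z.
by rewrite com // xz linear0r sub0r => /esym/eqP; rewrite oppr_eq0.
Qed.

Hypothesis nil_br : lie_nilpotent br.

(* Following x0 down the lower central series, one leaves P at the last step
   before reaching 0. *)
Lemma nilpotent_step (P : V -> Prop) (B : {vspace V}) :
  P 0 -> lie_ideal B -> (exists2 x, x \in B & ~ P x) ->
  exists x, [/\ x \in B, ~ P x & forall y, P (br y x)].
Proof.
move=> P0 idB [x0 x0B nPx0]; apply: contrapT => none.
have lcs k : exists x, [/\ x \in B, ~ P x & x \in lower_central br k].
  elim: k => [|k [x [xB nPx xk]]]; first by exists x0; rewrite memvf.
  have /existsNP[y nPy] : ~ forall y, P (br y x) by move=> Px; apply: none; exists x.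
  exists (br y x); split=> //; first exact: idB.
  have /lie_productP := subvv (lower_central br k.+1).
  by apply=> //; rewrite memvf.
have [k lcs0] := nil_br; have [x [_ nPx]] := lcs k.
by rewrite lcs0 memv0 => /eqP x0'; apply: nPx; rewrite x0'.
Qed.

(** The case of [nilpotent_step] where [P] is membership in [<<X>>]. Iterated, it builds flags of
    ideals; for empty [X] it yields a central vector. *)
Lemma flag_step (X : seq V) (B : {vspace V}) :
  free X -> lie_ideal B -> ~~ (B <= <<X>>)%VS ->
  exists x, [/\ x \in B, free (x :: X) & forall y, br y x \in <<X>>%VS].
Proof.
move=> freeX idB /subvPn[x0 x0B x0X].
have [||x [xB /negP xX brx]] := @nilpotent_step (fun x => x \in <<X>>%VS) B _ idB.
- exact: mem0v.
- by exists x0 => //; apply/negP.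
by exists x; rewrite free_cons xX.
Qed.

End Ideals.

(** * Explicit Ricci-flat metrics on two families of brackets *)

Section Dim6.
Variables (K : realFieldType) (V : vectType K) (br : {bilinear V -> V -> V}).
Hypothesis lie_br : is_lie_bracket br.

(* In the tables below, indices start from 0: the entry (i, j, k) is the
   coefficient of x_(k+1) in [x_(i+1), x_(j+1)] (listed for i > j only), resp. in
   nabla_(x_(i+1)) x_(j+1).  The connections come from the Koszul formula. *)
Definition codim2_bracket (a p5 p6 q6 r5 s5 b5 r6 s6 b6 u1 u2 u3 u4 : K)
    (i j k : nat) : K :=
  match i, j, k with
  | 5, 1, 0 => a
  | 4, 2, 0 => p5
  | 5, 2, 0 => p6 | 5, 2, 1 => q6
  | 4, 3, 0 => r5 | 4, 3, 1 => s5 | 4, 3, 2 => b5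
  | 5, 3, 0 => r6 | 5, 3, 1 => s6 | 5, 3, 2 => b6
  | 5, 4, 0 => u1 | 5, 4, 1 => u2 | 5, 4, 2 => u3 | 5, 4, 3 => u4
  | _, _, _ => 0
  end.

Definition codim2_nabla (h a p5 p6 q6 r5 s5 b5 r6 s6 b6 u1 u2 u3 u4 : K)
    (i j k : nat) : K :=
  match i, j, k with
  | 2, 4, 0 => - p5 / 2 + q6 / 2 + u4 / 2
  | 2, 5, 1 => p5 / 2 - q6 / 2 - u4 / 2
  | 3, 3, 0 => b6
  | 3, 3, 1 => b5
  | 3, 4, 0 => h * u4 / 2 - r5 / 2 + s6 / 2 + u3 / 2
  | 3, 4, 2 => - b5
  | 3, 5, 1 => - h * u4 / 2 + r5 / 2 - s6 / 2 - u3 / 2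
  | 3, 5, 2 => - b6
  | 4, 2, 0 => p5 / 2 + q6 / 2 + u4 / 2
  | 4, 3, 0 => h * u4 / 2 + r5 / 2 + s6 / 2 + u3 / 2
  | 4, 3, 1 => s5
  | 4, 4, 0 => u2
  | 4, 4, 2 => - s5
  | 4, 5, 1 => - u2
  | 4, 5, 2 => h * p5 / 2 + h * q6 / 2 - r5 / 2 - s6 / 2 - u3 / 2
  | 4, 5, 3 => - p5 / 2 - q6 / 2 - u4 / 2
  | 5, 1, 0 => a
  | 5, 2, 0 => p6
  | 5, 2, 1 => p5 / 2 + q6 / 2 - u4 / 2
  | 5, 3, 0 => r6
  | 5, 3, 1 => - h * u4 / 2 + r5 / 2 + s6 / 2 - u3 / 2
  | 5, 4, 0 => u1
  | 5, 4, 2 => h * p5 / 2 + h * q6 / 2 - r5 / 2 - s6 / 2 + u3 / 2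
  | 5, 4, 3 => - p5 / 2 - q6 / 2 + u4 / 2
  | 5, 5, 1 => - u1
  | 5, 5, 2 => h * p6 - r6
  | 5, 5, 3 => - p6
  | 5, 5, 4 => - a
  | _, _, _ => 0
  end.

Definition codim2_metric (h : K) (i j : nat) : K :=
  match i, j with
  | 0, 5 | 1, 4 | 2, 3 | 3, 2 | 4, 1 | 5, 0 => 1
  | 3, 3 => h
  | _, _ => 0
  end.

Definition codim2_metric_inv (h : K) (i j : nat) : K :=
  match i, j with
  | 0, 5 | 1, 4 | 2, 3 | 3, 2 | 4, 1 | 5, 0 => 1
  | 2, 2 => - h
  | _, _ => 0
  end.

Lemma codim2_frame_has_metric (x1 x2 x3 x4 x5 x6 : V)
    (a p5 p6 q6 r5 s5 b5 r6 s6 b6 u1 u2 u3 u4 : K) :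
    basis_of fullv [:: x1; x2; x3; x4; x5; x6] ->
    [/\ br x2 x1 = 0, br x3 x1 = 0, br x4 x1 = 0, br x5 x1 = 0 & br x6 x1 = 0] ->
    [/\ br x3 x2 = 0, br x4 x2 = 0, br x5 x2 = 0 & br x6 x2 = a *: x1] ->
    [/\ br x4 x3 = 0, br x5 x3 = p5 *: x1 & br x6 x3 = p6 *: x1 + q6 *: x2] ->
    br x5 x4 = r5 *: x1 + s5 *: x2 + b5 *: x3 ->
    br x6 x4 = r6 *: x1 + s6 *: x2 + b6 *: x3 ->
    br x6 x5 = u1 *: x1 + u2 *: x2 + u3 *: x3 + u4 *: x4 ->
    (p5 + q6 != 0) || (u4 != 0) ->
  has_ricci_flat_not_flat br.
Proof.
move=> bas [e21 e31 e41 e51 e61] [e32 e42 e52 e62] [e43 e53 e63] e54 e64 e65 nz.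
pose t := codim2_bracket a p5 p6 q6 r5 s5 b5 r6 s6 b6 u1 u2 u3 u4.
pose c i j k := t i j k - t j i k.
pose G (h : K) := codim2_nabla h a p5 p6 q6 r5 s5 b5 r6 s6 b6 u1 u2 u3 u4.
(* The component of R(x6, x5) x5 along x1 is affine in [h], and its slope is nonzero because the sum
   of squares is positive; hence it cannot vanish at both 0 and 1. *)
have [h nzh] : exists h, curvature_table 6 c (G h) 5 4 4 0 != 0.
  pose Q h := curvature_table 6 c (G h) 5 4 4 0.
  have QE h : Q h = Q 0 - h * (((p5 + q6) ^+ 2 + 3 * u4 ^+ 2) / 4).
    by rewrite /Q /curvature_table /c /t /G unlock /=; field.
  have [Q0|Q0] := eqVneq (Q 0) 0; last by exists 0.
  exists 1; rewrite -/(Q 1) QE Q0 sub0r mul1r oppr_eq0.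
  rewrite mulf_neq0 ?invr_eq0 ?pnatr_eq0 // gt_eqF //; case/orP: nz => nz.
    by rewrite ltr_pwDl ?exprn_even_gt0 // mulr_ge0 ?sqr_ge0.
  by rewrite ltr_wpDl ?sqr_ge0 // mulr_gt0 ?exprn_even_gt0.
pose b := [tuple x1; x2; x3; x4; x5; x6].
have eqs := (e21, e31, e41, e51, e61, e32, e42, e52, e62,
             e43, e53, e63, e54, e64, e65).
apply: (@ricci_flat_not_flat_tables _ _ 6 b bas br _ _
          (codim2_metric h) (codim2_metric_inv h) 5 4 4 0
          _ _ _ _ _ _ _ _ _ _ nzh) => //.
(* The goals are, in order: the bracket table, symmetry and inverse of the metric, torsion,
   compatibility, Ricci. Pairs with i < j reach the last rewrite, which flips the bracket before
   using [eqs]. *)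
- do 2!case=> [|[|[|[|[|[|//]]]]]]; move=> _ _; rewrite /c /t unlock /=;
    rewrite ?(br_xx lie_br, eqs) ?subrr ?subr0 ?sub0r ?scaleNr ?scale0r
      ?oppr0 ?scale0r ?addr0 ?add0r ?addrA //
      (br_anti lie_br) eqs ?opprD ?oppr0 ?addrA //.
- by do 2!case=> [|[|[|[|[|[|//]]]]]].
- by do 2!case=> [|[|[|[|[|[|//]]]]]]; move=> _ _; rewrite unlock /=; ring.
- by do 3!case=> [|[|[|[|[|[|//]]]]]]; move=> _ _ _; rewrite /c /t /G /=; field.
- by do 3!case=> [|[|[|[|[|[|//]]]]]]; move=> _ _ _; rewrite /G unlock /=; field.
- by do 2!case=> [|[|[|[|[|[|//]]]]]]; move=> _ _;
    rewrite /curvature_table /c /t /G unlock /=; field.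
Qed.

Definition selfcent_bracket (r5 b5 r6 s6 : K) (i j k : nat) : K :=
  match i, j, k with
  | 5, 1, 0 | 3, 2, 0 | 4, 2, 1 | 5, 4, 3 => 1
  | 4, 3, 0 => r5 | 4, 3, 2 => b5
  | 5, 3, 0 => r6 | 5, 3, 1 => s6
  | _, _, _ => 0
  end.

Definition selfcent_nabla (r5 b5 r6 s6 : K) (i j k : nat) : K :=
  match i, j, k with
  | 1, 4, 5 => 1
  | 1, 5, 0 => - 1
  | 2, 3, 0 => b5 / 2
  | 2, 4, 1 => - b5 / 2
  | 3, 2, 0 => 1 + b5 / 2
  | 3, 3, 5 => s6
  | 3, 4, 2 => - 1 - b5 / 2
  | 3, 4, 5 => r6
  | 3, 5, 0 => - r6
  | 3, 5, 1 => - s6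
  | 4, 1, 5 => 1
  | 4, 2, 1 => 1 - b5 / 2
  | 4, 3, 0 => r5
  | 4, 3, 2 => - 1 + b5 / 2
  | 4, 3, 5 => r6
  | 4, 4, 1 => - r5
  | 4, 5, 3 => - 1
  | _, _, _ => 0
  end.

(** The entry g(x4, x4) = r6 is forced: with h in its place, Ric(x5, x5) would be r6 - h. *)
Definition selfcent_metric (r6 : K) (i j : nat) : K :=
  match i, j with
  | 0, 4 | 1, 3 | 2, 2 | 3, 1 | 4, 0 | 5, 5 => 1
  | 3, 3 => r6
  | _, _ => 0
  end.

Definition selfcent_metric_inv (r6 : K) (i j : nat) : K :=
  match i, j with
  | 0, 4 | 1, 3 | 2, 2 | 3, 1 | 4, 0 | 5, 5 => 1
  | 1, 1 => - r6
  | _, _ => 0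
  end.

Lemma selfcent_frame_has_metric (x1 x2 x3 x4 x5 x6 : V) (r5 b5 r6 s6 : K) :
    basis_of fullv [:: x1; x2; x3; x4; x5; x6] ->
    [/\ br x2 x1 = 0, br x3 x1 = 0, br x4 x1 = 0, br x5 x1 = 0 & br x6 x1 = 0] ->
    [/\ br x3 x2 = 0, br x4 x2 = 0, br x5 x2 = 0 & br x6 x2 = x1] ->
    [/\ br x4 x3 = x1, br x5 x3 = x2 & br x6 x3 = 0] ->
    [/\ br x5 x4 = r5 *: x1 + b5 *: x3, br x6 x4 = r6 *: x1 + s6 *: x2 &
        br x6 x5 = x4] ->
  has_ricci_flat_not_flat br.
Proof.
move=> bas [e21 e31 e41 e51 e61] [e32 e42 e52 e62] [e43 e53 e63] [e54 e64 e65].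
pose t := selfcent_bracket r5 b5 r6 s6.
pose c i j k := t i j k - t j i k.
pose G := selfcent_nabla r5 b5 r6 s6.
(* The component of R(x5, x2) x2 along x1 is 1 for all values of the parameters. *)
have nz : curvature_table 6 c G 4 1 1 0 != 0.
  rewrite /curvature_table /c /t /G unlock /=.
  by rewrite (_ : _ + _ = 1) ?oner_eq0 //; ring.
pose b := [tuple x1; x2; x3; x4; x5; x6].
have eqs := (e21, e31, e41, e51, e61, e32, e42, e52, e62,
             e43, e53, e63, e54, e64, e65).
apply: (@ricci_flat_not_flat_tables _ _ 6 b bas br _ _
          (selfcent_metric r6) (selfcent_metric_inv r6) 4 1 1 0
          _ _ _ _ _ _ _ _ _ _ nz) => //.
- do 2!case=> [|[|[|[|[|[|//]]]]]]; move=> _ _; rewrite /c /t unlock /=;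
    rewrite ?(br_xx lie_br, eqs) ?subrr ?subr0 ?sub0r ?scaleNr ?scale0r
      ?scale1r ?oppr0 ?addr0 ?add0r ?addrA //
      (br_anti lie_br) eqs ?opprD ?oppr0 ?addrA //.
- by do 2!case=> [|[|[|[|[|[|//]]]]]].
- by do 2!case=> [|[|[|[|[|[|//]]]]]]; move=> _ _; rewrite unlock /=; ring.
- by do 3!case=> [|[|[|[|[|[|//]]]]]]; move=> _ _ _; rewrite /c /t /G /=; field.
- by do 3!case=> [|[|[|[|[|[|//]]]]]]; move=> _ _ _; rewrite /G unlock /=; field.
- by do 2!case=> [|[|[|[|[|[|//]]]]]]; move=> _ _;
    rewrite /curvature_table /c /t /G unlock /=; field.
Qed.

End Dim6.

(** * Construction of the adapted frames *)

Section Cases.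
Variables (K : realFieldType) (V : vectType K) (br : {bilinear V -> V -> V}).
Hypothesis lie_br : is_lie_bracket br.
Hypothesis nil_br : lie_nilpotent br.
Hypothesis dimV : \dim {:V} = 6%N.

Lemma free_basis6 (x1 x2 x3 x4 x5 x6 : V) :
  free [:: x6; x5; x4; x3; x2; x1] ->
  basis_of fullv [:: x1; x2; x3; x4; x5; x6].
Proof.
move=> freeX; rewrite basisEfree subvf dimV andbT.
rewrite (perm_free (Y := [:: x6; x5; x4; x3; x2; x1])) //.
by apply/permPl; exact: (perm_rev [:: x6; x5; x4; x3; x2; x1]).
Qed.

Lemma adapted_has_metric (x1 x2 x3 x4 x5 x6 : V) (a p5 p6 q6 : K) :
    free [:: x6; x5; x4; x3; x2; x1] ->
    {in <<[:: x4; x3; x2; x1]>>%VS &, forall x y, br x y = 0} ->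
    [/\ br x5 x1 = 0, br x6 x1 = 0, br x5 x2 = 0 & br x6 x2 = a *: x1] ->
    br x5 x3 = p5 *: x1 -> br x6 x3 = p6 *: x1 + q6 *: x2 ->
    br x5 x4 \in <<[:: x3; x2; x1]>>%VS -> br x6 x4 \in <<[:: x3; x2; x1]>>%VS ->
    br x6 x5 \in <<[:: x4; x3; x2; x1]>>%VS ->
    p5 + q6 != 0 ->
  has_ricci_flat_not_flat br.
Proof.
move=> freeX com [e51 e61 e52 e62] e53 e63.
move=> /span3P[r5 [s5 [b5 e54]]] /span3P[r6 [s6 [b6 e64]]].
move=> /span4P[u1 [u2 [u3 [u4 e65]]]] nz.
apply: (codim2_frame_has_metric lie_br (free_basis6 freeX)
          _ _ _ e54 e64 e65) => //.
- by split=> //; apply: com; rewrite memv_span // !inE eqxx ?orbT.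
- by split; [apply: com| apply: com|exact: e52|exact: e62];
     rewrite memv_span // !inE eqxx ?orbT.
- by split; [apply: com|exact: e53|exact: e63];
     rewrite memv_span // !inE eqxx ?orbT.
- by rewrite nz.
Qed.

(** The quotient by [I] is nilpotent of dimension 2, hence abelian: [x5] is central modulo [I], and
    only one further vector [x6] is needed to span. *)
Lemma codim2_ideal_derived (I : {vspace V}) :
  lie_ideal br I -> \dim I = 4%N -> forall x y, br x y \in I.
Proof.
move=> idI dimI.
have freeI := basis_free (vbasisP I).
have spanI : <<vbasis I>>%VS = I by apply: span_basis (vbasisP I).
have fullI : lie_ideal br fullv by move=> *; rewrite memvf.
have [|x5 [_ free5 br5]] := flag_step nil_br freeI fullI.
  by apply: subvN_span; rewrite size_tuple dimV dimI.
rewrite spanI in br5.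
have brW x y : y \in <<x5 :: vbasis I>>%VS -> br x y \in I.
  rewrite span_cons spanI => /memv_addP[_ /vlineP[k ->] [w wI ->]].
  by rewrite linearDr linearZr_LR /= memvD ?memvZ // idI.
have /subvPn[x6 _ x6W] : ~~ (fullv <= <<x5 :: vbasis I>>)%VS.
  by apply: subvN_span; rewrite /= size_tuple dimV dimI.
have spanV x : x \in <<x6 :: x5 :: vbasis I>>%VS.
  suff -> : <<x6 :: x5 :: vbasis I>>%VS = fullv by rewrite memvf.
  apply/eqP; rewrite eqEdim subvf dimV.
  have /eqP -> : free (x6 :: x5 :: vbasis I) by rewrite free_cons x6W.
  by rewrite /= size_tuple dimI.
move=> x y; have := spanV x; have := spanV y; rewrite span_cons.
move=> /memv_addP[_ /vlineP[k ->] [w wW ->]] /memv_addP[_ /vlineP[l ->] [t tW ->]].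
rewrite linearDr linearZr_LR /= memvD ?brW // memvZ // br_anti //.
rewrite linearDr linearZr_LR /= br_xx // scaler0 add0r memvN brW //.
Qed.

(** The cases differ in how much of [I] is central. In each, the flag in [I] and its complement are
    chosen so that p5 + q6 or u4 is nonzero. *)
Lemma abelian_codim2_ideal_has_metric (I : {vspace V}) :
    lie_ideal br I -> \dim I = 4%N -> {in I &, forall x y, br x y = 0} ->
    ~ lie_abelian br ->
  has_ricci_flat_not_flat br.
Proof.
move=> idI dimI comI nab.
have brI := codim2_ideal_derived idI dimI.
have spanI X : {subset X <= I} -> free X -> size X = 4%N -> <<X>>%VS = I.
  move=> sXI freeX sizeX; apply/eqP; rewrite eqEdim; apply/andP; split.
    by apply/span_subvP => x /sXI.
  by rewrite (eqP freeX) sizeX dimI.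
(* If [I] is central, any nonzero bracket [x6, x5] lies in [I] and can serve as x4, so that u4 = 1
   and all other coefficients vanish. *)
have [cenI|] := pselect (forall x, x \in I -> forall y, br y x = 0).
  have /existsNP[x6 /existsNP[x5 nz65]] : ~ lie_abelian br by [].
  pose x4 := br x6 x5.
  have x4I : x4 \in I by apply: brI.
  have free4 : free [:: x4] by rewrite seq1_free; apply/eqP.
  have step X : free X -> (size X < 4)%N -> exists2 x, x \in I & free (x :: X).
    move=> fX sX; have [|x [xI fx _]] := flag_step nil_br fX idI; last by exists x.
    by apply: subvN_span; rewrite dimI.
  have [x1 x1I free1] := step _ free4 isT.
  have [x2 x2I free2] := step _ free1 isT.
  have [x3 x3I free3] := step _ free2 isT.
  have spanX : <<[:: x3; x2; x1; x4]>>%VS = I.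
    by apply: spanI => // x; rewrite !inE => /or4P[]/eqP->.
  have x5I : x5 \notin I by apply/negP => /cenI x50; apply: nz65; rewrite x50.
  have free5 : free [:: x5; x3; x2; x1; x4] by rewrite free_cons free3 spanX x5I.
  have x6W : x6 \notin <<[:: x5; x3; x2; x1; x4]>>%VS.
    rewrite span_cons spanX; apply/negP => /memv_addP[_ /vlineP[k ->] [w wI x6E]].
    apply: nz65; rewrite x6E linearDl linearZl_LR /= br_xx // scaler0 add0r.
    by rewrite br_anti // cenI // oppr0.
  have free6 : free [:: x6; x5; x4; x3; x2; x1].
    rewrite (perm_free (Y := [:: x6; x5; x3; x2; x1; x4])).
      by rewrite free_cons x6W.
    do 2!rewrite perm_cons.
    by rewrite (perm_catC [:: x4] [:: x3; x2; x1]).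
  apply: (@codim2_frame_has_metric _ _ _ lie_br x1 x2 x3 x4 x5 x6
            0 0 0 0 0 0 0 0 0 0 0 0 0 1).
  - exact: free_basis6.
  - by split; rewrite cenI.
  - by split; rewrite cenI // scale0r.
  - by split; rewrite cenI // !scale0r ?addr0.
  - by rewrite cenI // !scale0r !addr0.
  - by rewrite cenI // !scale0r !addr0.
  - by rewrite !scale0r !add0r scale1r.
  - by rewrite oner_eq0 orbT.
move=> ncen.
(* Otherwise [I] contains a vector [x] that is central only modulo the centre. *)
have [||x [xI ncx cbrx]] :=
    @nilpotent_step _ _ _ nil_br (fun x => forall y, br y x = 0) I _ idI.
- by move=> y; rewrite linear0r.
- by have /existsNP[x /not_implyP[xI ncx]] := ncen; exists x.
have /existsNP[y nzyx] := ncx.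
pose x1 := br y x.
have x1I : x1 \in I by apply: idI.
have cx1 z : br z x1 = 0 by apply: cbrx.
have free1 : free [:: x1] by rewrite seq1_free; apply/eqP.
have yI : y \notin I by apply/negP => yI; apply: nzyx; apply: comI.
have [[w [wI cw wx1]]|only_x1] :=
    pselect (exists w, [/\ w \in I, forall z, br z w = 0 & w \notin <<[:: x1]>>%VS]).
  have /subvPn[x6 _ x6W] : ~~ (fullv <= <<y :: vbasis I>>)%VS.
    by apply: subvN_span; rewrite /= size_tuple dimV dimI.
  (* Here [x] takes the place of x3 and [y] that of x5, so p5 = 1. For x2 take [x6, x] if it is
     independent of x1, giving q6 = 1, and otherwise the central [w], giving q6 = 0; then p5 + q6 is
     2 or 1. *)
  have [x2 [p6 [q6 [x2I cx2 x2x1 yx q6nz]]]] : exists x2 p6 q6,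
      [/\ x2 \in I, forall z, br z x2 = 0, x2 \notin <<[:: x1]>>%VS,
          br x6 x = p6 *: x1 + q6 *: x2 & 1 + q6 != 0 :> K].
    have [/span1P[k yxE]|yxN] := boolP (br x6 x \in <<[:: x1]>>%VS).
      by exists w, k, 0; split; rewrite ?scale0r ?addr0 ?oner_eq0.
    exists (br x6 x), 0, 1; rewrite scale0r add0r scale1r; split; rewrite ?yxN //.
    by rewrite (pnatr_eq0 K 2).
  have free2 : free [:: x2; x1] by rewrite free_cons x2x1.
  have free3 : free [:: x; x2; x1].
    rewrite free_cons free2 andbT; apply/negP => /span2P[k1 [k2 xE]].
    by apply: ncx => z; rewrite xE linearDr !linearZr_LR /= cx1 cx2 !scaler0 addr0.
  have [|x4 [x4I free4 brx4]] := flag_step nil_br free3 idI.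
    by apply: subvN_span; rewrite dimI.
  have spanX : <<[:: x4; x; x2; x1]>>%VS = I.
    by apply: spanI => // z; rewrite !inE => /or4P[]/eqP->.
  have free6 : free [:: x6; y; x4; x; x2; x1].
    rewrite free_cons free_cons free4 spanX yI span_cons spanX !andbT.
    by move: x6W; rewrite span_cons (span_basis (vbasisP I)).
  apply: (adapted_has_metric (a := 0) (p5 := 1) free6 _ _ _ yx) => //.
  - by rewrite spanX.
  - by split; rewrite ?cx1 ?cx2 // scale0r.
  - by rewrite scale1r.
  - by rewrite spanX.
(* Now the centre meets [I] in the line of x1. The vector [x] takes the place of x2, and a multiple
   of [y] that of x6. *)
have cen_x1 w : w \in I -> (forall z, br z w = 0) -> w \in <<[:: x1]>>%VS.
  by move=> wI cw; apply: contrapT => /negP wx1; apply: only_x1; exists w.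
have /subvPn[y5 _ y5W] : ~~ (fullv <= <<y :: vbasis I>>)%VS.
  by apply: subvN_span; rewrite /= size_tuple dimV dimI.
have /span1P[k y5x] : br y5 x \in <<[:: x1]>>%VS.
  by apply: cen_x1 => [|z]; [exact: idI|exact: cbrx].
(* Both [y] and [y5] send [x] into the line of x1; this combination commutes with [x]. *)
pose x5 := y5 - k *: y.
have x5x : br x5 x = 0.
  by rewrite /x5 linearBl linearZl_LR /= y5x subrr.
have x5W : x5 \notin <<y :: vbasis I>>%VS.
  apply: contra y5W => x5W; rewrite -[y5](subrK (k *: y)) memvD // memvZ //.
  by rewrite memv_span // inE eqxx.
have free2 : free [:: x; x1].
  rewrite free_cons free1 andbT; apply/negP => /span1P[l xE].
  by apply: ncx => z; rewrite xE linearZr_LR /= cx1 scaler0.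
have [|x3 [x3I free3 brx3]] := flag_step nil_br free2 idI.
  by apply: subvN_span; rewrite dimI.
have [|x4 [x4I free4 brx4]] := flag_step nil_br free3 idI.
  by apply: subvN_span; rewrite dimI.
have spanX : <<[:: x4; x3; x; x1]>>%VS = I.
  by apply: spanI => // z; rewrite !inE => /or4P[]/eqP->.
have /span2P[p5 [q5 x53]] := brx3 x5.
have /span2P[p6 [q6 x63]] := brx3 y.
(* Jacobi for y, x5, x3: [[y, x5], x3] vanishes since [I] is abelian, [x5, [y, x3]] since x5
   commutes with x1 and [x], and what remains is q5 x1. *)
have q5_0 : q5 = 0.
  have := lie_jacobi lie_br y x5 x3.
  rewrite (comI _ _ (brI y x5) x3I) x53 x63 !linearDr !linearZr_LR /= !cx1 x5x.
  rewrite !scaler0 !add0r subr0 -/x1 => /esym/eqP.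
  by rewrite scaler_eq0 => /orP[/eqP//|/eqP/nzyx].
rewrite q5_0 scale0r addr0 in x53.
(* Scaling [y] by s multiplies q6 by s and leaves p5 alone, so s = 1 or s = -1 works unless p5 = q6
   = 0. In that case x3 - p6 x would be central, hence a multiple of x1, against freeness. *)
have [s nzs nz] : exists2 s : K, s != 0 & p5 + s * q6 != 0.
  have [pq0|] := eqVneq (p5 + q6) 0; last first.
    by move=> nz; exists 1; rewrite ?mul1r ?oner_eq0.
  have [q6_0|q6nz] := eqVneq q6 0; last first.
    exists (-1); first by rewrite oppr_eq0 oner_eq0.
    move/eqP: pq0; rewrite addr_eq0 => /eqP ->.
    by rewrite mulN1r -opprD oppr_eq0 -mulr2n mulrn_eq0.
  have p5_0 : p5 = 0 by rewrite q6_0 addr0 in pq0.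
  rewrite {}p5_0 scale0r in x53; rewrite {}q6_0 scale0r addr0 in x63.
  have : x3 - p6 *: x \in <<[:: x1]>>%VS.
    apply: cen_x1 => [|z]; first by rewrite memvB ?memvZ.
    have : z \in <<x5 :: y :: vbasis I>>%VS.
      suff -> : <<x5 :: y :: vbasis I>>%VS = fullv by rewrite memvf.
      apply/eqP; rewrite eqEdim subvf dimV.
      have /eqP -> : free (x5 :: y :: vbasis I).
        rewrite !free_cons x5W (basis_free (vbasisP I)) andbT.
        by rewrite (span_basis (vbasisP I)).
      by rewrite /= size_tuple dimI.
    rewrite 2!span_cons (span_basis (vbasisP I)).
    move=> /memv_addP[_ /vlineP[k5 ->] [_ /memv_addP[_ /vlineP[k6 ->] [t tI ->]] ->]].
    rewrite !linearDl !linearZl_LR !linearBr !linearZr_LR /= x53 x63 x5x.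
    rewrite (comI t x3) // (comI t x) // -/x1.
    by rewrite !(scaler0, subrr, addr0).
  move/span1P => [l /eqP x3E].
  move: free3; rewrite free_cons => /andP[/negP[]].
  move: x3E; rewrite subr_eq => /eqP ->.
  by rewrite memvD // memvZ // memv_span // !inE eqxx ?orbT.
apply: (adapted_has_metric (a := s) (p6 := s * p6) (q6 := s * q6) (x6 := s *: y)
          (x5 := x5) (x4 := x4) (x2 := x) _ _ _ x53 _ _ _ _ nz).
- have x5I : x5 \notin I.
    apply: contra x5W => x5I; rewrite span_cons (span_basis (vbasisP I)).
    by rewrite -[x5]add0r memv_add ?mem0v.
  rewrite free_cons free_cons free4 spanX x5I !andbT span_cons spanX.
  apply: contra x5W => /memv_addP[_ /vlineP[l ->] [t tI yE]].
  rewrite span_cons (span_basis (vbasisP I)).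
  have [l0|nzl] := eqVneq l 0.
    case/negP: yI; rewrite -[y]scale1r -(mulVf nzs) -scalerA yE l0 scale0r add0r.
    by rewrite memvZ.
  have lx5 : l *: x5 = s *: y - t by rewrite yE addrK.
  rewrite -[x5]scale1r -(mulVf nzl) -scalerA lx5 memvZ // memv_add ?memvN //.
  by rewrite memvZ ?memv_line.
- by rewrite spanX.
- by split; rewrite ?cx1 // linearZl_LR.
- by rewrite linearZl_LR /= x63 scalerDr !scalerA.
- exact: brx4.
- exact: brx4.
- by rewrite spanX.
Qed.

(** The hypothesis [self] says that the span of x1, x2, x3 contains its centralizer. Dimension
    counts then supply vectors acting on it in prescribed ways, and Jacobi determines their mutual
    brackets. *)
Lemma selfcentralizing_has_metric (x1 x2 x3 : V) :
    free [:: x3; x2; x1] -> (forall y, br y x1 = 0) ->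
    (forall y, br y x2 \in <<[:: x1]>>%VS) ->
    br x2 x3 = 0 -> (forall y, br y x3 \in <<[:: x2; x1]>>%VS) ->
    (forall y, br x2 y = 0 -> br x3 y = 0 -> y \in <<[:: x3; x2; x1]>>%VS) ->
  has_ricci_flat_not_flat br.
Proof.
move=> free3 cx1 brx2 br23 brx3 self.
have free2 : free [:: x2; x1] by move: free3; rewrite free_cons => /andP[].
have free1 : free [:: x1] by move: free2; rewrite free_cons => /andP[].
have x1c y : br x1 y = 0 by rewrite br_anti // cx1 oppr0.
pose C2 := lker (ad br x2).
have C2P y : (y \in C2) = (br x2 y == 0) := mem_lker_ad br x2 y.
have C2ideal : lie_ideal br C2.
  rewrite -[C2]capfv; apply: centralizer_ideal => // [y z _|y z _]; first exact: memvf.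
  by have /span1P[k ->] := brx2 y; rewrite linearZl_LR /= x1c scaler0.
have dimC2 : (5 <= \dim C2)%N.
  have := limg_ker_dim (ad br x2) fullv; rewrite dimV capfv -/C2.
  suff : (\dim (limg (ad br x2)) <= 1)%N by move=> ? ?; lia.
  apply: leq_trans (dim_span [:: x1]); apply: dimvS.
  apply/subvP => _ /memv_imgP[y _ ->]; rewrite adE br_anti // memvN; exact: brx2.
(* On [C2], the kernel of ad x3 has dimension at most 3 by [self] and its image at most 2, while
   [C2] has dimension at least 5; so the bounds on [C2] and on the image are attained. *)
have imC2 : (ad br x3 @: C2)%VS = <<[:: x2; x1]>>%VS /\ (\dim C2 <= 5)%N.
  have sub : (ad br x3 @: C2 <= <<[:: x2; x1]>>)%VS.
    by apply/subvP => _ /memv_imgP[y _ ->]; rewrite adE br_anti // memvN.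
  have := limg_ker_dim (ad br x3) C2.
  have : (\dim (C2 :&: lker (ad br x3)) <= 3)%N.
    apply: leq_trans (dim_span [:: x3; x2; x1]); apply: dimvS.
    by apply/subvP => y; rewrite memv_cap C2P mem_lker_ad => /andP[/eqP/self + /eqP].
  have := dimvS sub; rewrite (eqP free2) /= => dim2 dim3 dims.
  split; last by lia.
  apply/eqP; rewrite eqEdim sub (eqP free2) /=; lia.
have {imC2}[imC2 dimC2'] := imC2.
have preim w : w \in <<[:: x2; x1]>>%VS -> exists2 y, y \in C2 & br y x3 = w.
  rewrite -memvN -imC2 => /memv_imgP[y yC2]; rewrite adE => wE.
  by exists y; rewrite // br_anti // -wE opprK.
have [|y4 y4C2 y43] := preim x1; first by rewrite memv_span // !inE eqxx orbT.
have [|x5 x5C2 x53] := preim x2; first by rewrite memv_span // !inE eqxx.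
have /subvPn[y6 _ y6C2] : ~~ (fullv <= C2)%VS.
  by apply: contraL dimC2' => /dimvS; rewrite dimV -ltnNge.
have /span1P[k y62] := brx2 y6.
have nzk : k != 0.
  apply: contraNneq y6C2 => k0; rewrite C2P br_anti // y62 k0 scale0r oppr0 //.
have /span2P[l [m y63]] := brx3 y6.
(* Subtracting [y4] and [x5] cancels the action of [y6] on x3 without changing [y6, x2], as both
   commute with x2; the factor normalizes [x6, x2] to x1. *)
pose x6 := k^-1 *: (y6 - l *: y4 - m *: x5).
have c2 y : y \in C2 -> br y x2 = 0.
  by rewrite C2P => /eqP x2y; rewrite br_anti // x2y oppr0.
have x62 : br x6 x2 = x1.
  rewrite /x6 linearZl_LR /= !linearBl !linearZl_LR /= (c2 _ y4C2) (c2 _ x5C2).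
  by rewrite !scaler0 !subr0 y62 scalerA mulVf ?scale1r.
have x63 : br x6 x3 = 0.
  rewrite /x6 linearZl_LR /= !linearBl !linearZl_LR /= y63 y43 x53.
  by rewrite addrAC addrK subrr scaler0.
(* Defining x4 as this bracket makes [x6, x5] exact; Jacobi still gives [x4, x3] = [x6, x2] = x1,
   which is why [y4] itself is not kept. *)
pose x4 := br x6 x5.
have x4C2 : x4 \in C2 by apply: C2ideal.
have x43 : br x4 x3 = x1.
  by rewrite lie_jacobi // x53 x63 x62 linear0r subr0.
have selfr y : y \in C2 -> br y x3 = 0 -> y \in <<[:: x3; x2; x1]>>%VS.
  by rewrite C2P => /eqP ? y3; apply: self => //; rewrite br_anti // y3 oppr0.
(* This bracket commutes with x2 because [C2] is an ideal and with x3 by Jacobi, so [self] applies;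
   likewise for [x6, x4]. *)
have /span3P[r5 [s5 [b5 x54]]] : br x5 x4 \in <<[:: x3; x2; x1]>>%VS.
  apply: selfr; first exact: C2ideal.
  by rewrite lie_jacobi // x43 x53 cx1 (c2 _ x4C2) subrr.
have /span3P[r6 [s6 [b6 x64]]] : br x6 x4 \in <<[:: x3; x2; x1]>>%VS.
  apply: selfr; first exact: C2ideal.
  by rewrite lie_jacobi // x43 x63 cx1 linear0r subrr.
have nz2 : x2 != 0 by apply: contraTneq free2 => ->; rewrite free_cons mem0v.
(* Jacobi for x6, x5, x4 reads 0 = s5 x1 - b6 x2, because [[x6, x5], x4] = [x4, x4]. *)
have [s5_0 b6_0] : s5 = 0 /\ b6 = 0.
  have := lie_jacobi lie_br x6 x5 x4.
  rewrite -/x4 br_xx // x54 x64 !linearDr !linearZr_LR /= !cx1 x62 x63 (c2 _ x5C2) x53.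
  rewrite !scaler0 !add0r addr0 => /esym/eqP; rewrite subr_eq0 => /eqP s5E.
  have b6_0 : b6 = 0.
    apply: contraTeq free2 => nzb; rewrite free_cons negb_and negbK.
    by rewrite -[x2]scale1r -(mulVf nzb) -scalerA -s5E !memvZ // memv_span ?inE.
  split=> //; apply: contraTeq free1 => nzs; rewrite seq1_free negbK.
  by move/eqP: s5E; rewrite b6_0 scale0r scaler_eq0 (negbTE nzs).
rewrite {}s5_0 scale0r addr0 in x54; rewrite {}b6_0 scale0r addr0 in x64.
have x1C2 : x1 \in C2 by rewrite C2P cx1.
have x2C2 : x2 \in C2 by rewrite C2P br_xx.
have x3C2 : x3 \in C2 by rewrite C2P br23.
(* Independence is read off from the action: [x4, x3] = x1 is nonzero, [x5, x3] = x2 is not a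
   multiple of x1, and x6 does not commute with x2. *)
have free4 : free [:: x4; x3; x2; x1].
  rewrite free_cons free3 andbT; apply/negP => /span3P[k1 [k2 [k3 x4E]]].
  move: free1; rewrite seq1_free -x43 x4E !linearDl !linearZl_LR /= x1c br23 br_xx //.
  by rewrite !scaler0 !addr0 eqxx.
have free5 : free [:: x5; x4; x3; x2; x1].
  rewrite free_cons free4 andbT; apply/negP => /span4P[k1 [k2 [k3 [k4 x5E]]]].
  move: free2; rewrite free_cons -{1}x53 x5E !linearDl !linearZl_LR /= x1c br23 br_xx //.
  by rewrite !scaler0 !add0r x43 memvZ ?memv_span // inE eqxx.
have free6 : free [:: x6; x5; x4; x3; x2; x1].
  rewrite free_cons free5 andbT; apply: contraTN free1 => x6W.
  rewrite seq1_free negbK -x62 c2 //; apply: (subvP _ _ x6W).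
  by apply/span_subvP => y; rewrite !inE => /or4P[| | |/orP[]]/eqP->.
apply: (selfcent_frame_has_metric lie_br (free_basis6 free6)
  (r5 := r5) (b5 := b5) (r6 := r6) (s6 := s6)) => //.
by split=> //; apply: c2.
Qed.

Lemma nilpotent_dim6_has_metric : ~ lie_abelian br -> has_ricci_flat_not_flat br.
Proof.
move=> nab.
have full_ideal : lie_ideal br fullv by move=> *; rewrite memvf.
have [|x1 [_ free1 brx1]] := flag_step nil_br (@nil_free K V) full_ideal.
  by apply: subvN_span; rewrite dimV.
have cx1 y : br y x1 = 0 by move: (brx1 y); rewrite span_nil memv0 => /eqP.
have [|x2 [_ free2 brx2]] := flag_step nil_br free1 full_ideal.
  by apply: subvN_span; rewrite dimV.
pose C2 := lker (ad br x2).
have C2P y : (y \in C2) = (br x2 y == 0) := mem_lker_ad br x2 y.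
have br1 y : br x1 y = 0 by rewrite br_anti // cx1 oppr0.
have C2ideal : lie_ideal br C2.
  rewrite -[C2]capfv; apply: centralizer_ideal => // y z _.
  by have /span1P[k ->] := brx2 y; rewrite linearZl_LR /= br1 scaler0.
(* Drawing x3 from [C2] makes it commute with x2. There is room, since ad x2 has rank at most 1 and
   [C2] has dimension at least 5. *)
have [|x3 [x3C2 free3 brx3]] := flag_step nil_br free2 C2ideal.
  apply: subvN_span => /=; have := limg_ker_dim (ad br x2) fullv.
  rewrite dimV capfv -/C2.
  suff : (\dim (limg (ad br x2)) <= 1)%N by lia.
  apply: leq_trans (dim_span [:: x1]); apply: dimvS.
  by apply/subvP => _ /memv_imgP[y _ ->]; rewrite adE br_anti // memvN.
(* As x1 is central, this is the centralizer of the span of x1, x2, x3; a vector of it outside that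
   span extends the flag to an abelian ideal of dimension 4. *)
pose C3 := (C2 :&: lker (ad br x3))%VS.
have [sC3|nsC3] := boolP (C3 <= <<[:: x3; x2; x1]>>)%VS.
  apply: (selfcentralizing_has_metric free3) => //.
    by apply/eqP; rewrite -C2P.
  move=> y y2 y3; apply: (subvP sC3).
  by rewrite memv_cap C2P y2 mem_lker_ad y3 !eqxx.
have C3ideal : lie_ideal br C3.
  apply: centralizer_ideal => // y z; rewrite C2P => /eqP x2z.
  have /span2P[k1 [k2 ->]] := brx3 y.
  by rewrite linearDl !linearZl_LR /= br1 x2z !scaler0 addr0.
have [x4 [x4C3 free4 brx4]] := flag_step nil_br free3 C3ideal nsC3.
have /andP[x24 x34] : (br x2 x4 == 0) && (br x3 x4 == 0).
  by move: x4C3; rewrite memv_cap C2P mem_lker_ad.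
have x23 : br x2 x3 = 0 by apply/eqP; rewrite -C2P.
have x32 : br x3 x2 = 0 by rewrite br_anti // x23 oppr0.
apply: (abelian_codim2_ideal_has_metric (I := <<[:: x4; x3; x2; x1]>>%VS)) => //.
- apply: span_ideal => y x; rewrite !inE.
  have sub X u : u \in <<X>>%VS -> {subset X <= [:: x4; x3; x2; x1]} ->
      u \in <<[:: x4; x3; x2; x1]>>%VS.
    by move=> uX sX; apply: subvP uX; apply: sub_span.
  case/or4P => /eqP ->; last by rewrite cx1 mem0v.
  - by apply: sub (brx4 y) _ => z; rewrite !inE => ->; rewrite orbT.
  - by apply: sub (brx3 y) _ => z; rewrite !inE => ->; rewrite !orbT.
  - by apply: sub (brx2 y) _ => z; rewrite !inE => ->; rewrite !orbT.
- by rewrite (eqP free4).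
- apply: span_commute => // x y; rewrite !inE.
  by case/or4P=> /eqP->; case/or4P=> /eqP->;
    rewrite ?br_xx ?cx1 ?br1 ?x23 ?x32 ?(eqP x24) ?(eqP x34) //;
    rewrite br_anti // ?(eqP x24) ?(eqP x34) oppr0.
Qed.

End Cases.

Theorem corollary5p9 (R : realType) (V : vectType R)
    (br : {bilinear V -> V -> V}) (lie_br : is_lie_bracket br)
    (dimV : \dim {:V} = 6%N) (nil_br : lie_nilpotent br)
    (nonab_br : ~ lie_abelian br) :
  exists (g : {symmetric V}) (nabla : {bilinear V -> V -> V}),
    [/\ nondegenerate g, levi_civita br g nabla,
        ricci_flat br nabla & ~ flat br nabla].
Proof. exact: nilpotent_dim6_has_metric lie_br nil_br dimV nonab_br. Qed.
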